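(* Let $p$ be a prime, let $\mathbb{F}$ be a finite field of characteristic $p$, and let $s_1,s_2\in \mathrm{A}_p=\{0,1,\dots,p-1\}$. Consider a series $$f=\sum_{i,j>0} f_{\left(\frac{-s_1}{p^{i}},\frac{-s_2}{p^{j}}\right)}\,t_1^{\frac{-s_1}{p^{i}}}t_2^{\frac{-s_2}{p^{j}}}\in \mathbb{F}((t_1^{\mathbb{Q}},t_2^{\mathbb{Q}})),$$ i.e. a generalized power series whose support is contained in $\{(-s_1/p^i,-s_2/p^j): i,j\in\mathbb{Z}_{>0}\}$. Then $f$ is algebraic over $\mathbb{F}((t_1,t_2))$ if and only if both of the following hold: (1) there exist positive integers $M$ and $N$ such that, for all $i_0,j_0\in\mathbb{Z}_{>0}$, the sequence $a_n=f_{\left(\frac{-s_1}{p^{i_0+n}},\frac{-s_2}{p^{j_0+n}}\right)}$ ($n\ge 0$) has period $N$ after $M$ terms; (2) for every $i\in\mathbb{Z}_{>0}$ the sequence $b_n=f_{\left(\frac{-s_1}{p^{i}},\frac{-s_2}{p^{n}}\right)}$ ($n\geq 1$) is eventually periodic, and for every $j\in\mathbb{Z}_{>0}$ the sequence $c_n=f_{\left(\frac{-s_1}{p^{n}},\frac{-s_2}{p^{j}}\right)}$ ($n\ge 1$) is eventually periodic.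
   Context: For a field $\Bbbk$, $\Bbbk((t_1^{\mathbb{Q}},t_2^{\mathbb{Q}}))$ denotes the field of generalized power series (Hahn series) $f=\sum_{(\alpha_1,\alpha_2)\in\mathbb{Q}\times\mathbb{Q}}f_{(\alpha_1,\alpha_2)}t_1^{\alpha_1}t_2^{\alpha_2}$ with coefficients $f_{(\alpha_1,\alpha_2)}\in\Bbbk$ whose support $\{\alpha: f_\alpha\neq 0\}$ is well-ordered, where $\mathbb{Q}\times\mathbb{Q}$ carries a fixed total group order in which $(1,0)$ and $(0,1)$ are positive (e.g. the lexicographic order); sum and product are the usual ones. $f_\alpha$ always denotes the coefficient of $f$ at the exponent $\alpha$ (zero off the support). $\Bbbk((t_1,t_2))$ is the fraction field of the power series ring $\Bbbk[[t_1,t_2]]$, regarded as a subfield of $\Bbbk((t_1^{\mathbb{Q}},t_2^{\mathbb{Q}}))$. A sequence $(a_n)$ is eventually periodic if there exist a positive integer $s$ and an integer $m$ with $a_{n+s}=a_n$ for all $n\ge m$; it has period $N$ after $M$ terms if $a_{n+N}=a_n$ for all $n\ge M$. *)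

(* Defs.v *)
From HB Require Import structures.
From mathcomp Require Import all_boot all_order all_algebra.
From mathcomp Require Import boolp classical_sets functions cardinality fsbigop.

Set Implicit Arguments.
Unset Strict Implicit.
Unset Printing Implicit Defensive.

Import Order.TTheory GRing.Theory Num.Theory.

Local Open Scope classical_set_scope.
Local Open Scope ring_scope.

(* The strict order is [~~ gle y x]; by antisymmetry x != 0 is positive iff
   [gle 0 x]. *)
Record totalGroupOrder (G : zmodType) := TotalGroupOrder {
  gle :> rel G;
  gle_anti : antisymmetric gle;
  gle_trans : transitive gle;
  gle_total : total gle;
  gle_addr : forall c a b : G, gle a b -> gle (a + c) (b + c)
}.

Section WellOrdered.
Variables (G : zmodType) (le : totalGroupOrder G).

Definition wellOrdered (S : set G) :=
  forall X : set G, X `<=` S -> X !=set0 ->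
    exists2 m, X m & forall x, X x -> le m x.

Lemma gle_refl a : le a a.
Proof. by have := gle_total le a a; case: (le a a). Qed.

Lemma gnle a b : ~~ le b a -> le a b.
Proof. by have := gle_total le a b; case/orP => [//|->]. Qed.

Lemma gle_add2r c a b : le (a + c) (b + c) = le a b.
Proof.
apply/idP/idP; last exact: gle_addr.
by move=> /(gle_addr (- c)); rewrite !addrK.
Qed.

Lemma gle_add2l c a b : le (c + a) (c + b) = le a b.
Proof. by rewrite ![c + _]addrC gle_add2r. Qed.

Lemma gle_add a b c d : le a b -> le c d -> le (a + c) (b + d).
Proof.
move=> ab cd; apply: (@gle_trans _ le (b + c)).
  by rewrite gle_add2r.
by rewrite gle_add2l.
Qed.

Lemma gle_subl c a b : le (c - a) (c - b) = le b a.
Proof.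
rewrite -(gle_add2r (a + b)) addrA subrK addrCA subrK.
by rewrite [a + c]addrC gle_add2l.
Qed.

Lemma sub_wellOrdered (S T : set G) :
  S `<=` T -> wellOrdered T -> wellOrdered S.
Proof. by move=> ST woT X XS; apply: woT; exact: subset_trans ST. Qed.

Lemma wellOrdered1 a : wellOrdered [set a].
Proof.
move=> X Xa [x Xx]; exists x => // y Xy.
by rewrite (Xa _ Xx) (Xa _ Xy) gle_refl.
Qed.

Lemma wellOrderedU (S T : set G) :
  wellOrdered S -> wellOrdered T -> wellOrdered (S `|` T).
Proof.
move=> woS woT X XST X0.
have [[x [Xx Sx]]|XS0] := pselect ((X `&` S) !=set0); last first.
  apply: woT => // x Xx; have [Sx|//] := XST _ Xx.
  by case: XS0; exists x.
have [||m [Xm Sm] mP] := woS (X `&` S); [by move=> ? [] | by exists x |].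
have [[y [Xy Ty]]|XT0] := pselect ((X `&` T) !=set0); last first.
  exists m => // y Xy; apply: mP; split=> //.
  by have [//|Ty] := XST _ Xy; case: XT0; exists y.
have [||n [Xn Tn] nP] := woT (X `&` T); [by move=> ? [] | by exists y |].
have [mn|nm] := orP (gle_total le m n).
  exists m => // z Xz; have [Sz|Tz] := XST _ Xz; first exact: mP.
  by apply: (gle_trans mn); apply: nP.
exists n => // z Xz; have [Sz|Tz] := XST _ Xz; last exact: nP.
by apply: (gle_trans nm); apply: mP.
Qed.

Lemma wellOrderedD (S T : set G) : wellOrdered S -> wellOrdered T ->
  wellOrdered [set x | exists2 s, S s & exists2 t, T t & x = s + t].
Proof.
move=> woS woT X XST X0.
pose rec (Y : set G) t := T t /\ exists2 s, S s & Y (s + t) /\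
  (forall s' t', S s' -> T t' -> Y (s' + t') -> ~~ le (s + t) (s' + t') ->
     ~~ le t t').
have recex (Y : set G) : Y `<=` X -> Y !=set0 -> exists t, rec Y t.
  move=> YX [y Yy].
  have [s0 Ss0 [t0 Tt0 y0]] := XST _ (YX _ Yy).
  have [|s [Ss [t1 Tt1 Yst1]] smin] :=
      woS [set s | S s /\ exists2 t, T t & Y (s + t)] _ (ex_intro _ s0 (conj Ss0 (ex_intro2 _ _ t0 Tt0 (eq_ind _ Y Yy _ y0)))).
    by move=> ? [].
  have [|t [Tt Yst] tmin] := woT [set t | T t /\ Y (s + t)] _ (ex_intro _ t1 (conj Tt1 Yst1)).
    by move=> ? [].
  exists t; split=> //; exists s => //; split=> // s' t' Ss' Tt' Yst'.
  apply: contra => tt'; apply: gle_add => //; apply: smin.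
  by split=> //; exists t'.
have [t1 rt1] := recex X (fun _ => id) X0.
have [|t [Tt [s Ss [Xst stP]]] tmin] := woT (rec X) _ (ex_intro _ t1 rt1).
  by move=> ? [].
exists (s + t) => // x Xx; apply: contrapT => /negP stx.
pose Y := [set y | X y /\ ~~ le (s + t) y].
have [|t' [Tt' [s' Ss' [[Xs't' lt'] s't'P]]]] :=
    recex Y _ (ex_intro _ x (conj Xx stx)).
  by move=> ? [].
have /negP[] := stP _ _ Ss' Tt' Xs't' lt'.
apply: tmin; split=> //; exists s' => //; split=> // s2 t2 Ss2 Tt2 Xst2 lt2.
apply: (s't'P s2) => //; split=> //; apply: contra lt2; apply: gle_trans.
exact: gnle.
Qed.

Lemma wellOrderedMn x : le 0 x -> wellOrdered [set x *+ n | n in [set: nat]].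
Proof.
move=> x0 X Xx [y Xy]; have [k _ ky] := Xx _ Xy.
have exk : exists n, `[< X (x *+ n) >] by exists k; apply/asboolP; rewrite ky.
case: (ex_minnP exk) => m /asboolP Xm mP; exists (x *+ m) => // z Xz.
have [n _ nz] := Xx _ Xz.
have /mP mn : `[< X (x *+ n) >] by apply/asboolP; rewrite nz.
rewrite -nz -(subnKC mn) mulrnDr -[x in le x _]addr0 gle_add2l.
elim: (n - m)%N => [|i IH]; first exact: gle_refl.
by rewrite mulrS -[0]addr0 gle_add.
Qed.

Lemma finite_minmax (X : set G) :
  (forall Y, Y `<=` X -> Y !=set0 -> exists2 m, Y m & forall y, Y y -> le m y) ->
  (forall Y, Y `<=` X -> Y !=set0 -> exists2 m, Y m & forall y, Y y -> le y m) ->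
  finite_set X.
Proof.
move=> mins maxs.
pose X0 := [set x | X x /\ finite_set [set y | X y /\ le y x]].
have X0X : X0 `<=` X by move=> ? [].
have [XX0|/existsNP[x /not_implyP[Xx nX0x]]] := pselect (X `<=` X0).
  have [->|/set0P X0n] := eqVneq X set0; first exact: finite_set0.
  have [m Xm mP] := maxs X (fun _ => id) X0n.
  have [_] := XX0 _ Xm; apply: sub_finite_set => y Xy; split=> //.
  exact: mP.
have [|m [Xm nX0m] mP] := mins [set x | X x /\ ~ X0 x] _ (ex_intro _ x (conj Xx nX0x)).
  by move=> ? [].
case: nX0m; split=> //.
pose L := [set y | X y /\ ~~ le m y].
have LX0 y : L y -> X0 y.
  by move=> [Xy lemy]; apply: contrapT => nX0y; move/negP: lemy; apply; apply: mP.
have Lsub : [set y | X y /\ le y m] `<=` L `|` [set m].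
  move=> y [Xy ym]; have [my|nmy] := boolP (le m y); last by left.
  by right; apply/(@gle_anti _ le); rewrite ym my.
apply: (sub_finite_set Lsub); rewrite finite_setU; split; last exact: finite_set1.
have [->|/set0P L0] := eqVneq L set0; first exact: finite_set0.
have [|y0 Ly0 y0P] := maxs L _ L0; first by move=> ? [].
have [_] := LX0 _ Ly0; apply: sub_finite_set => y Ly; split; last exact: y0P.
by case: Ly.
Qed.

Lemma finite_conv (S T : set G) c : wellOrdered S -> wellOrdered T ->
  finite_set [set a | S a /\ T (c - a)].
Proof.
move=> woS woT; apply: finite_minmax => Y YX Y0.
  by apply: woS => // y /YX[].
have [||m [y Yy <-] mP] := woT [set c - y | y in Y].
- by move=> _ [y /YX[_ ?] <-].
- by case: Y0 => y Yy; exists (c - y); exists y.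
exists y => // z Yz; rewrite -(gle_subl c); apply: mP; by exists z.
Qed.

End WellOrdered.

Section HahnType.
Variables (F : fieldType) (G : zmodType) (le : totalGroupOrder G).

(* A generalized power series is its coefficient function; [hahn] is given its
   field structure below, with the convolution product. *)
Definition hahn_pred : {pred G -> F} :=
  fun f => `[< wellOrdered le [set a | f a != 0] >].

Record hahn := Hahn { hcoef :> G -> F; _ : hahn_pred hcoef }.

HB.instance Definition _ := [isSub for hcoef].
HB.instance Definition _ := [Choice of hahn by <:].

Lemma hahn_zmod_closed : zmod_closed hahn_pred.
Proof.
split=> [|f g /asboolP wof /asboolP wog]; apply/asboolP.
  by move=> X X0 [x /X0]; rewrite /= eqxx.
apply: sub_wellOrdered (wellOrderedU wof wog) => a /=.
have [f0|] := eqVneq (f a) 0; last by left.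
by move=> h; right; apply: contraNneq h => g0; rewrite !fctE f0 g0 subrr.
Qed.
HB.instance Definition _ :=
  GRing.isZmodClosed.Build _ hahn_pred hahn_zmod_closed.
HB.instance Definition _ := [SubChoice_isSubZmodule of hahn by <:].

Implicit Types f g h : hahn.

Lemma hahnP f g : (forall a, f a = g a) -> f = g.
Proof. by move=> fg; apply/val_inj/funext. Qed.

Lemma hahn_wo f : wellOrdered le [set a | f a != 0].
Proof. by case: f => f /= /asboolP. Qed.
Arguments hahn_wo : clear implicits.

Lemma hahn0E a : (0 : hahn) a = 0. Proof. by []. Qed.
Lemma hahnDE f g a : (f + g) a = f a + g a. Proof. by []. Qed.
Lemma hahnNE f a : (- f) a = - f a. Proof. by []. Qed.
Lemma hahnBE f g a : (f - g) a = f a - g a. Proof. by []. Qed.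

Definition hmul_fun f g : G -> F := fun c => \sum_(a \in [set: G]) f a * g (c - a).

Lemma finite_hmul f g c : finite_set [set a | f a != 0 /\ g (c - a) != 0].
Proof. exact: (finite_conv c (hahn_wo f) (hahn_wo g)). Qed.

Lemma hmul_fun_seq f g c (s : seq G) : uniq s ->
  (forall a, f a != 0 -> g (c - a) != 0 -> a \in s) ->
  hmul_fun f g c = \sum_(a <- s) f a * g (c - a).
Proof.
move=> us sP; rewrite /hmul_fun.
rewrite [RHS]fsbig_seq //; symmetry; apply: fsbig_widen => // a [_ /= /negP nas]; apply/eqP; apply: contraNT nas.
by rewrite mulf_eq0 negb_or => /andP[]; exact: sP.
Qed.

Lemma hmul_fun_ex f g c : exists2 s : seq G, uniq s &
  forall a, f a != 0 -> g (c - a) != 0 -> a \in s.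
Proof.
have /finite_seqP[s sE] := finite_hmul f g c.
exists (undup s); first exact: undup_uniq.
move=> a fa ga; rewrite mem_undup.
by have : [set` s] a by rewrite -sE.
Qed.

Lemma hmul_fun_neq0 f g c : hmul_fun f g c != 0 ->
  exists a, f a != 0 /\ g (c - a) != 0.
Proof.
apply: contra_neqP => /forallNP fg0; rewrite (@hmul_fun_seq _ _ _ [::]) ?big_nil //.
by move=> a fa ga; case: (fg0 a).
Qed.

Lemma hmul_subproof f g : hahn_pred (hmul_fun f g).
Proof.
apply/asboolP; apply: sub_wellOrdered (wellOrderedD (hahn_wo f) (hahn_wo g)).
move=> c /hmul_fun_neq0[a [fa ga]]; exists a => //; exists (c - a) => //.
by rewrite addrC subrK.
Qed.

Definition hmul f g := Hahn (hmul_subproof f g).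

Definition hmono_fun (x : F) (a : G) : G -> F :=
  fun b => if b == a then x else 0.

Lemma hmono_subproof x a : hahn_pred (hmono_fun x a).
Proof.
apply/asboolP; apply: sub_wellOrdered (@wellOrdered1 _ le a) => b /=.
by rewrite /hmono_fun; case: ifP => [/eqP->|_] //; rewrite eqxx.
Qed.

Definition hmono x a := Hahn (hmono_subproof x a).

Definition hone := hmono 1 0.

Lemma hmulC : commutative hmul.
Proof.
move=> f g; apply: hahnP => c /=; have [s us sP] := hmul_fun_ex f g c.
rewrite (hmul_fun_seq us sP) (@hmul_fun_seq _ _ _ [seq c - a | a <- s]).
- by rewrite big_map; apply: eq_bigr => a _; rewrite mulrC subKr.
- by rewrite map_inj_uniq // => a b /addrI/oppr_inj.
- by move=> a ga fa; apply/mapP; exists (c - a); rewrite ?subKr // sP // subKr.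
Qed.

Lemma hmonoM_coef x a f c : hmul (hmono x a) f c = x * f (c - a).
Proof.
rewrite /= (@hmul_fun_seq _ _ _ [:: a]) ?big_seq1 /= /hmono_fun ?eqxx // => b.
by rewrite inE; case: (b == a); rewrite ?eqxx.
Qed.

Lemma hmul1 : left_id hone hmul.
Proof. by move=> f; apply: hahnP => c; rewrite hmonoM_coef mul1r subr0. Qed.

Lemma hmulDl : left_distributive hmul +%R.
Proof.
move=> f g h; apply: hahnP => c; rewrite hahnDE /=.
have [s us sP] := hmul_fun_ex f h c; have [t ut tP] := hmul_fun_ex g h c.
pose r := undup (s ++ t).
have ur : uniq r by exact: undup_uniq.
rewrite !(@hmul_fun_seq _ _ _ r) //.
- by rewrite -big_split; apply: eq_bigr => a _; rewrite hahnDE mulrDl.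
- by move=> a ga ha; rewrite mem_undup mem_cat tP ?orbT.
- by move=> a fa ha; rewrite mem_undup mem_cat sP.
move=> a fga ha; rewrite mem_undup mem_cat.
have [fa|fa] := eqVneq (f a) 0; last by rewrite sP.
by rewrite tP ?orbT //; apply: contraNneq fga; rewrite hahnDE fa add0r => ->.
Qed.

Lemma hmulA : associative hmul.
Proof.
move=> f g h; apply: hahnP => c; rewrite /=.
have woD f1 f2 := wellOrderedD (hahn_wo f1) (hahn_wo f2).
have /finite_seqP[A0 A0E] := finite_conv c (woD f g) (hahn_wo h).
have /finite_seqP[B0 B0E] := finite_conv c (hahn_wo f) (woD g h).
pose A := undup A0; pose B := undup B0.
have uA : uniq A by exact: undup_uniq.
have uB : uniq B by exact: undup_uniq.
have AP a x : f x != 0 -> g (a - x) != 0 -> h (c - a) != 0 -> a \in A.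
  move=> fx gx ha; rewrite mem_undup.
  have : [set` A0] a; last by [].
  rewrite -A0E; split=> //; exists x => //; exists (a - x) => //.
  by rewrite addrC subrK.
have BP a x : f x != 0 -> g (a - x) != 0 -> h (c - a) != 0 -> x \in B.
  move=> fx gx ha; rewrite mem_undup.
  have : [set` B0] x; last by [].
  rewrite -B0E; split=> //; exists (a - x) => //; exists (c - a) => //.
  by rewrite [RHS]addrC addrA subrK.
have subE d x : c - (d + x) = c - x - d by rewrite opprD addrA addrAC.
rewrite (@hmul_fun_seq f _ c B) //; last first.
  move=> x fx /hmul_fun_neq0[d [gd hd]].
  by apply: (BP (d + x)) => //; rewrite ?addrK ?subE.
rewrite (@hmul_fun_seq _ h c A) //; last first.
  by move=> a /hmul_fun_neq0[x [fx gx]] ha; apply: AP fx gx ha.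
transitivity (\sum_(x <- B) \sum_(a <- A) f x * g (a - x) * h (c - a)).
  apply: eq_bigr => x _; have [->|fx] := eqVneq (f x) 0.
    by rewrite mul0r big1 // => a _; rewrite !mul0r.
  rewrite /= (@hmul_fun_seq _ _ _ [seq a - x | a <- A]).
  - rewrite big_map mulr_sumr; apply: eq_bigr => a _; rewrite mulrA.
    by rewrite opprB addrA subrK.
  - by rewrite map_inj_uniq // => a b /addIr.
  move=> d gd hd; rewrite -(addrK x d); apply: map_f.
  by apply: (AP _ x) => //; rewrite ?addrK ?subE.
rewrite exchange_big /=; apply: eq_bigr => a _.
have [->|ha] := eqVneq (h (c - a)) 0.
  by rewrite mulr0 big1 // => x _; rewrite mulr0.
rewrite -mulr_suml (@hmul_fun_seq _ _ _ B) // => x fx gx.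
exact: BP fx gx ha.
Qed.

Lemma hone_neq0 : hone != 0.
Proof.
apply/eqP => /(congr1 (fun f : hahn => f 0)) /=.
by rewrite /hmono_fun eqxx => /eqP; rewrite oner_eq0.
Qed.

HB.instance Definition _ := GRing.Zmodule_isComNzRing.Build hahn
  hmulA hmulC hmul1 hmulDl hone_neq0.

Lemma hmonoME x a f c : (hmono x a * f) c = x * f (c - a).
Proof. exact: hmonoM_coef. Qed.

Lemma hahnME f g c (s : seq G) : uniq s ->
  (forall a, f a != 0 -> g (c - a) != 0 -> a \in s) ->
  (f * g) c = \sum_(a <- s) f a * g (c - a).
Proof. exact: hmul_fun_seq. Qed.

Lemma hahnM_neq0 f g c : (f * g) c != 0 ->
  exists a, f a != 0 /\ g (c - a) != 0.
Proof. exact: hmul_fun_neq0. Qed.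

Lemma hahn_lead f : f != 0 ->
  exists2 m, f m != 0 & forall a, f a != 0 -> le m a.
Proof.
move=> f0; apply: (hahn_wo f) => //.
apply: contrapT => /forallNP nf; case/eqP: f0; apply: hahnP => a.
by apply/eqP; rewrite -[_ == _]negbK; apply/negP/nf.
Qed.

(* The coefficient of f * g at c only sees the coefficients of f up to c - v,
   if v is the order of g. *)
Lemma eq_hahnM_coef f1 f2 g v c : (forall a, g a != 0 -> le v a) ->
  (forall a, le (a + v) c -> f1 a = f2 a) -> (f1 * g) c = (f2 * g) c.
Proof.
move=> gv f12.
have gP a : g (c - a) != 0 -> le (a + v) c.
  by move/gv; rewrite -(gle_add2r le a) subrK addrC.
have [s us sP] := hmul_fun_ex f1 g c; rewrite !(@hahnME _ _ _ s) //.
  apply: eq_bigr => a _; have [->|ga] := eqVneq (g (c - a)) 0.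
    by rewrite !mulr0.
  by rewrite f12 ?gP.
by move=> a f2a ga; apply: sP => //; rewrite f12 ?gP.
Qed.

Section Inverse.
Variables (f : hahn) (v : G).
Hypotheses (fv : f v != 0) (vP : forall a, f a != 0 -> le v a).

Let lt a b := ~~ le b a.

(* Truncations of the inverse of f. *)
Let approx h :=
  forall a b, h a != 0 -> (1 - h * f) b != 0 -> lt (a + v) b.

Let T := {h : hahn | `[< approx h >]}.

Let ext (h1 h2 : hahn) := (forall a, h1 a != 0 -> h2 a = h1 a) /\
  (forall a b, h1 a != 0 -> h1 b = 0 -> h2 b != 0 -> lt a b).

Let extT (h1 h2 : T) := `[< ext (val h1) (val h2) >].

Lemma hahn_inv_ex_aux : exists h, h * f = 1.
Proof.
have [|h1 h2 h3 /asboolP[e12 l12] /asboolP[e23 l23]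
  |h1 h2 /asboolP[e12 _] /asboolP[e21 _]|A totA|[h hP] hmax] := @Zorn T extT.
- by move=> h; apply/asboolP; split=> // a b _ ->; rewrite eqxx.
- apply/asboolP; split=> [a h1a|a b h1a h1b h3b].
    by rewrite -e12 // e23 // e12.
  have [h2b|h2b] := eqVneq (val h2 b) 0.
    by apply: l23 h2b h3b; rewrite e12.
  exact: l12 h1b h2b.
- apply/val_inj/hahnP => a; have [h1a|h1a] := eqVneq (val h1 a) 0.
    have [->//|h2a] := eqVneq (val h2 a) 0; exact: e21.
  by rewrite e12.
- pose P a (h : T) := A h /\ val h a != 0.
  pose u a := if pselect (exists h : T, P a h) is left e then val (sval (cid e)) a else 0.
  have uE (h : T) a : A h -> val h a != 0 -> u a = val h a.
    move=> Ah ha; rewrite /u; case: pselect => [e|[]]; last by exists h.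
    case: cid => h' [Ah' h'a] /=.
    by case: (totA _ _ Ah Ah') => /asboolP[E _]; rewrite E.
  have uex a : u a != 0 -> exists h : T, P a h.
    by rewrite /u; case: pselect => // _; rewrite eqxx.
  have ult (h : T) a b : A h -> val h a != 0 -> val h b = 0 -> u b != 0 -> lt a b.
    move=> Ah ha hb ub; have [h' [Ah' h'b]] := uex _ ub.
    case: (totA _ _ Ah Ah') => /asboolP[E L]; first exact: L ha hb h'b.
    by move: (h'b); rewrite -(E _ h'b) hb eqxx.
  have uwo : hahn_pred u.
    apply/asboolP => X Xu [x Xx]; have [h [Ah hx]] := uex _ (Xu _ Xx).
    have [||m [Xm hm] mP] := @hahn_wo (val h) (X `&` [set a | val h a != 0]).
    + by move=> ? [].
    + by exists x.
    exists m => // y Xy; have [hy|hy] := eqVneq (val h y) 0; last exact: mP.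
    by apply: gnle; apply: (ult h) => //; apply: Xu.
  have uap : approx (Hahn uwo).
    move=> a b ua nb; have [h [Ah ha]] := uex _ ua.
    apply: contraNN nb => bav.
    have /asboolP hap := valP h.
    rewrite hahnBE (@eq_hahnM_coef _ (val h) f v) // => [|d dvb /=].
      rewrite -hahnBE; apply: contraTT bav => nb; exact: hap ha nb.
    have [hd|hd] := eqVneq (val h d) 0; last exact: uE.
    apply/eqP; apply: contraTT dvb => ud.
    have := ult h a d Ah ha hd; rewrite -hd => /(_ ud) lad.
    apply: contraNN lad => dvb; rewrite -(gle_add2r le v).
    exact: gle_trans dvb bav.
  exists (exist _ (Hahn uwo) (asboolT uap)) => h Ah; apply/asboolP; split=> /=.
    by move=> a ha; apply: uE.
  by move=> a b; apply: ult.
exists h; apply/eqP; rewrite eq_sym -subr_eq0; apply: contrapT => /negP nz.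
have [d nd dP] := hahn_lead nz.
have /asboolP hap := hP.
pose e := (1 - h * f) d / f v.
pose h' := h + hmono e (d - v).
have e0 : e != 0 by rewrite mulf_neq0 ?invr_eq0.
have hlt a : h a != 0 -> lt a (d - v).
  by move=> ha; have := hap _ _ ha nd; rewrite /lt -(gle_add2r le v (d - v)) subrK.
have hdv : h (d - v) = 0.
  by apply/eqP; apply: contraT => /hlt; rewrite /lt gle_refl.
have h'E a : a != d - v -> h' a = h a.
  by rewrite hahnDE /= /hmono_fun => /negbTE->; rewrite addr0.
have h'dv : h' (d - v) = e by rewrite hahnDE /= /hmono_fun eqxx hdv add0r.
have h'le a : h' a != 0 -> le a (d - v).
  have [->|/h'E->] := eqVneq a (d - v); first by rewrite gle_refl.
  by move/hlt/gnle.
have h'ap : approx h'.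
  move=> a b h'a; apply: contraNN => bav.
  have bd : le b d.
    apply: (gle_trans bav); have := h'le _ h'a.
    by rewrite -(gle_add2r le v) subrK.
  rewrite mulrDl opprD addrA hahnDE hahnNE hmonoME.
  have [->|nbd] := eqVneq b d.
    by rewrite subKr divfK // subrr.
  have /eqP-> : (1 - h * f) b == 0.
    apply: contraNT nbd => nb; apply/eqP/(@gle_anti _ le).
    by rewrite bd dP.
  suff /eqP-> : f (b - (d - v)) == 0 by rewrite mulr0 subr0.
  apply: contraNT nbd => /vP; rewrite -(gle_add2r le (d - v)) subrK addrC subrK => db.
  by apply/eqP/(@gle_anti _ le); rewrite bd.
have /(congr1 val)/= hh' : exist _ h' (asboolT h'ap) = exist _ h hP :> T.
  apply: hmax; apply/asboolP; split=> [a ha|a b ha hb h'b].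
    by apply: h'E; apply: contraNneq ha => ->; rewrite hdv.
  have [->|nb] := eqVneq b (d - v); first exact: hlt.
  by case/eqP: h'b; exact: etrans (h'E b nb) hb.
by move: e0; rewrite -h'dv hh' hdv eqxx.
Qed.

End Inverse.

Lemma hahn_inv_ex f : exists h, f != 0 -> h * f = 1.
Proof.
have [->|/hahn_lead[v fv vP]] := eqVneq f 0; first by exists 0.
by have [h hf] := hahn_inv_ex_aux fv vP; exists h.
Qed.

Definition hinv f := if f == 0 then 0 else sval (cid (hahn_inv_ex f)).

Lemma hmulVf f : f != 0 -> hinv f * f = 1.
Proof. by move=> f0; rewrite /hinv ifN //; case: cid => h /= ->. Qed.

Lemma hinv0 : hinv 0 = 0.
Proof. by rewrite /hinv ifT. Qed.

HB.instance Definition _ := GRing.ComNzRing_isField.Build hahn hmulVf hinv0.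

End HahnType.

Section PowerSeries2.
Variables (F : fieldType) (le : totalGroupOrder (rat * rat)%type).
Local Notation H := (hahn F le).

(* F[[t1, t2]] inside the Hahn series: when (1, 0) and (0, 1) are positive,
   every array of coefficients occurs, see [powerSeries2_ex]. *)
Definition powerSeries2 : {pred H} := fun f =>
  `[< forall a, f a != 0 -> exists m n : nat, a = (m%:R, n%:R) >].

Lemma powerSeries2_ex (c : nat -> nat -> F) :
  le 0 (1, 0) -> le 0 (0, 1) ->
  exists2 f, f \in powerSeries2 & forall m n : nat, f (m%:R, n%:R) = c m n.
Proof.
move=> le10 le01.
pose P a mn := a = (mn.1%:R, mn.2%:R) :> rat * rat.
pose f a := if pselect (exists mn : nat * nat, P a mn) is left e
            then c (sval (cid e)).1 (sval (cid e)).2 else 0.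
have fP a : f a != 0 -> exists m n : nat, a = (m%:R, n%:R).
  rewrite /f; case: pselect => [[[m n] aE] _|]; last by rewrite eqxx.
  by exists m, n; exact: aE.
have mulE m n : (m%:R, n%:R) = (1, 0) *+ m + (0, 1) *+ n :> rat * rat.
  have E1 : (1, 0) *+ m = (m%:R, 0) :> rat * rat.
    by elim: m => // m IH; rewrite mulrS IH [RHS]surjective_pairing mulrS.
  have E2 : (0, 1) *+ n = (0, n%:R) :> rat * rat.
    by elim: n => // n IH; rewrite mulrS IH [RHS]surjective_pairing mulrS.
  by rewrite E1 E2; congr pair; rewrite /= ?addr0 ?add0r.
have fwo : hahn_pred le f.
  apply/asboolP; apply: sub_wellOrdered
    (wellOrderedD (wellOrderedMn le10) (wellOrderedMn le01)) => a /fP[m [n ->]].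
  by exists ((1, 0) *+ m); [exists m|exists ((0, 1) *+ n); [exists n|]].
exists (Hahn fwo); first exact/asboolP.
move=> m n /=; rewrite /f; case: pselect => [e|[]]; last by exists (m, n).
case: cid => -[m' n'] /= [/eqP + /eqP +].
by rewrite !eqr_nat => /eqP-> /eqP->.
Qed.

Lemma powerSeries2_subring : subring_closed powerSeries2.
Proof.
split=> [|f g /asboolP fP /asboolP gP|f g /asboolP fP /asboolP gP];
  apply/asboolP => a.
- rewrite /= /hmono_fun; case: ifP => [/eqP -> _|_]; last by rewrite eqxx.
  by exists 0, 0.
- have [fa|/fP//] := eqVneq (f a) 0; rewrite hahnBE fa sub0r oppr_eq0.
  exact: gP.
move=> /hahnM_neq0[b [/fP[m [n ->]] /gP[m' [n' e]]]].
exists (m + m')%N, (n + n')%N; rewrite -[a](subrK (m%:R, n%:R)) e.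
by rewrite !natrD addrC.
Qed.
HB.instance Definition _ :=
  GRing.isSubringClosed.Build H powerSeries2 powerSeries2_subring.

Definition fracPowerSeries2_pred : {pred H} := fun f =>
  `[< exists g h, [/\ g \in powerSeries2, h \in powerSeries2, h != 0 & f = g / h] >].

Lemma fracPowerSeries2_divring : divring_closed fracPowerSeries2_pred.
Proof.
split=> [|f1 f2 /asboolP[g1 [h1 [g1P h1P h10 ->]]] /asboolP[g2 [h2 [g2P h2P h20 ->]]]
  |f1 f2 /asboolP[g1 [h1 [g1P h1P h10 ->]]] /asboolP[g2 [h2 [g2P h2P h20 ->]]]];
  apply/asboolP.
- by exists 1, 1; rewrite rpred1 oner_eq0 divr1.
- exists (g1 * h2 - g2 * h1), (h1 * h2).
  rewrite rpredB ?rpredM // mulf_neq0 //; split=> //.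
  by rewrite -mulNr addf_div // mulNr.
have [->|g20] := eqVneq g2 0.
  by exists 0, 1; rewrite rpred0 rpred1 oner_eq0 !mul0r invr0 mulr0.
exists (g1 * h2), (h1 * g2).
by rewrite !rpredM // mulf_neq0 // invf_div mulf_div.
Qed.
HB.instance Definition _ :=
  GRing.isDivringClosed.Build H fracPowerSeries2_pred fracPowerSeries2_divring.

(* F((t1, t2)), with [\val] as its embedding into the Hahn series. *)
Record fracPowerSeries2 := FracPowerSeries2 {
  fracPowerSeries2_val :> H;
  _ : fracPowerSeries2_pred fracPowerSeries2_val
}.

HB.instance Definition _ := [isSub for fracPowerSeries2_val].
HB.instance Definition _ := [Choice of fracPowerSeries2 by <:].
HB.instance Definition _ :=
  [SubChoice_isSubIntegralDomain of fracPowerSeries2 by <:].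
HB.instance Definition _ :=
  [SubIntegralDomain_isSubField of fracPowerSeries2 by <:].

End PowerSeries2.

Definition periodicAfter (T : Type) (a : nat -> T) (N M : nat) :=
  forall n, (M <= n)%N -> a (n + N)%N = a n.

(* A sequence indexed by n >= 1 is encoded as a function on nat; its junk value
   at 0 is harmless here, as M can always be increased. *)
Definition eventuallyPeriodic (T : Type) (a : nat -> T) :=
  exists N M, (0 < N)%N /\ periodicAfter a N M.

Definition negExponent (p s1 s2 i j : nat) : rat * rat :=
  (- (s1%:R / p%:R ^+ i), - (s2%:R / p%:R ^+ j)).

(* Main.v *)
Require Import Defs.
From mathcomp Require Import all_boot all_order all_algebra.
From mathcomp Require Import boolp classical_sets functions cardinality fsbigop.
From mathcomp Require Import finfield zify ring lra.

(* Let q = #|F| = p ^ e and let phi(i, j) be the coefficient of f at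
   (- s1 / p ^ i, - s2 / p ^ j). Then f ^ (q ^ k) shifts both indices of phi by
   e k.

   If f is algebraic, its powers f ^ (q ^ k) satisfy a linear relation whose
   coefficients a_k are power series. For s < p and i > 0 the fractional part of
   - s / p ^ i determines s / p ^ i, so the coefficient of the relation at
   (u - s1 / p ^ i, v - s2 / p ^ j) reads
     sum_k a_k(u, v) phi(i + e k, j + e k) = 0,
   a linear recurrence over a finite field that is independent of i and j; its
   polynomial divides some X^m (X^N - 1), which bounds all the periods at once.
   For a single column, look at exponents (u - s1 / p ^ i, w), where w is the
   least value of n - s2 q^k / p^j with a_k(u, n) != 0: only the columns up to j
   occur, and column j occurs with a nonzero polynomial in the shift, which
   gives (2) by induction on j.

   Conversely, cutting off the indices at most B changes f by finitely many
   algebraic series, and if f_B is the remaining series, then (1) gives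
   f_{B + e N} ^ (q ^ N) = f_B, an algebraic equation for f_{B + e N}. The rows
   and columns that were cut off are treated in the same way. *)

Set Implicit Arguments.
Unset Strict Implicit.
Unset Printing Implicit Defensive.

Import Order.TTheory GRing.Theory Num.Theory.
Local Open Scope ring_scope.

(** * Linear recurrences *)

Section ShiftOperator.
Variable F : fieldType.
Implicit Types (P Q : {poly F}) (w : nat -> F).

(** The action of P(S) on sequences, S being the shift: sequences form a module over F[X], by
    [shiftopM]. *)
Definition shiftop P w n := \sum_(k < size P) P`_k * w (n + k)%N.

Lemma shiftopE m P w n : (size P <= m)%N ->
  shiftop P w n = \sum_(k < m) P`_k * w (n + k)%N.
Proof.
move=> Pm; rewrite /shiftop.
rewrite (big_ord_widen m (fun k => P`_k * w (n + k)%N) Pm) big_mkcond /=.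
apply: eq_bigr => k _; case: ltnP => // sPk.
by rewrite nth_default // mul0r.
Qed.

Lemma shiftopD P Q w n : shiftop (P + Q) w n = shiftop P w n + shiftop Q w n.
Proof.
have [sP sQ] := (leq_maxl (size P) (size Q), leq_maxr (size P) (size Q)).
rewrite (shiftopE _ _ (size_polyD P Q)) (shiftopE _ _ sP) (shiftopE _ _ sQ).
by rewrite -big_split; apply: eq_bigr => k _; rewrite coefD mulrDl.
Qed.

Lemma shiftopZ c P w n : shiftop (c *: P) w n = c * shiftop P w n.
Proof.
rewrite (shiftopE _ _ (size_scale_leq c P)) mulr_sumr.
by apply: eq_bigr => k _; rewrite coefZ mulrA.
Qed.

Lemma shiftop0 w n : shiftop 0 w n = 0.
Proof. by rewrite /shiftop size_poly0 big_ord0. Qed.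

Lemma shiftop_sum (I : Type) (r : seq I) (P : I -> {poly F}) w n :
  shiftop (\sum_(i <- r) P i) w n = \sum_(i <- r) shiftop (P i) w n.
Proof.
elim: r => [|i r IH]; first by rewrite !big_nil shiftop0.
by rewrite !big_cons shiftopD IH.
Qed.

Lemma shiftopXn m w n : shiftop 'X^m w n = w (n + m)%N.
Proof.
rewrite (@shiftopE m.+1) ?size_polyXn // (bigD1 ord_max) //= coefXn eqxx mul1r.
rewrite big1 ?addr0 // => k; rewrite -val_eqE /= => /negbTE km.
by rewrite coefXn km mul0r.
Qed.

Lemma shiftopM P Q w n : shiftop (P * Q) w n = shiftop P (shiftop Q w) n.
Proof.
rewrite -{1}(coefK P) poly_def mulr_suml shiftop_sum.
apply: eq_bigr => k _; rewrite -scalerAl shiftopZ; congr (_ * _).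
rewrite -{1}(coefK Q) poly_def mulr_sumr shiftop_sum.
apply: eq_bigr => m _; rewrite -scalerAr shiftopZ -exprD shiftopXn.
by rewrite addnA.
Qed.

Lemma shiftop_seqD P w1 w2 n :
  shiftop P (fun i => w1 i + w2 i) n = shiftop P w1 n + shiftop P w2 n.
Proof. by rewrite -big_split; apply: eq_bigr => k _; rewrite mulrDr. Qed.

(** The torsion of this module: sequences satisfying some linear recurrence. *)
Definition annihilated w := exists2 P, P != 0 & forall n, shiftop P w n = 0.

Lemma eq_shiftop P w1 w2 n : w1 =1 w2 -> shiftop P w1 n = shiftop P w2 n.
Proof. by move=> e; apply: eq_bigr => k _; rewrite e. Qed.

Lemma shiftop_seq0 P n : shiftop P (fun=> 0) n = 0.
Proof. by rewrite /shiftop big1 // => k _; rewrite mulr0. Qed.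

Lemma annihilated_shiftop P w :
  P != 0 -> annihilated (shiftop P w) -> annihilated w.
Proof.
move=> P0 [Q Q0 Qw]; exists (Q * P); first exact: mulf_neq0.
by move=> n; rewrite shiftopM.
Qed.

Lemma annihilated_shiftopr P w : annihilated w -> annihilated (shiftop P w).
Proof.
move=> [Q Q0 Qw]; exists Q => // n.
by rewrite -shiftopM mulrC shiftopM (eq_shiftop _ _ Qw) shiftop_seq0.
Qed.

Lemma annihilated_sum (I : eqType) (r : seq I) (w : I -> nat -> F) :
  (forall i, i \in r -> annihilated (w i)) ->
  annihilated (fun n => \sum_(i <- r) w i n).
Proof.
elim: r => [_|i r IH rP].
  by exists 1; [exact: oner_neq0 | move=> n; apply: big1 => k _; rewrite big_nil mulr0].
have [P P0 Pw] := rP i (mem_head _ _).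
have [|Q Q0 Qw] := IH; first by move=> j jr; apply: rP; rewrite inE jr orbT.
exists (P * Q); first exact: mulf_neq0.
move=> n; pose v n := \sum_(j <- r) w j n.
rewrite (@eq_shiftop _ _ (fun n => w i n + v n)); last by move=> m; rewrite big_cons.
rewrite shiftop_seqD mulrC shiftopM (eq_shiftop _ _ Pw) shiftop_seq0 add0r.
by rewrite mulrC shiftopM (eq_shiftop _ _ Qw) shiftop_seq0.
Qed.

Lemma annihilatedN w : annihilated (fun n => - w n) -> annihilated w.
Proof.
move=> [P P0 Pw]; exists P => // n; apply: oppr_inj.
by rewrite oppr0 -(Pw n) /shiftop -sumrN; apply: eq_bigr => k _; rewrite mulrN.
Qed.

End ShiftOperator.

(** * Linear recurrences over a finite field *)

Section FiniteRecurrence.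
Variable F : finFieldType.

(* Pigeonhole: there are finitely many residues modulo P. *)
Lemma dvdp_Xn_sub_Xn (P : {poly F}) : P != 0 ->
  exists a b, (a < b)%N /\ P %| 'X^b - 'X^a.
Proof.
move=> P0; pose B := #|{: 'rV[F]_(size P)}|.
pose g (i : 'I_B.+1) : 'rV[F]_(size P) := poly_rV ('X^i %% P).
have : ~ injective g.
  by move=> /leq_card; rewrite card_ord ltnn.
move=> /injectiveP/injectivePn[i [j ij gij]].
have rE : 'X^i %% P = 'X^j %% P.
  rewrite -[LHS](@poly_rV_K _ (size P)); last by rewrite ltnW // ltn_modp.
  rewrite -[RHS](@poly_rV_K _ (size P)); last by rewrite ltnW // ltn_modp.
  by congr rVpoly.
have D (a b : nat) : 'X^a %% P = 'X^b %% P -> P %| 'X^b - 'X^a.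
  by move=> e; rewrite /dvdp modpD modpN e subrr.
have /orP[lij|lij] : ((i < j) || (j < i))%N by rewrite -neq_ltn.
  by exists i, j; split=> //; apply: D.
by exists j, i; split=> //; apply: D.
Qed.

(** A sequence killed by P is killed by some multiple X^b - X^a of P, with a < b. These exponents
    depend on P alone, so M and N serve all such sequences at once. *)
Lemma shiftop_periodic (P : {poly F}) : P != 0 ->
  exists M N, [/\ (0 < M)%N, (0 < N)%N & forall w,
    (forall n, shiftop P w n = 0) -> periodicAfter w N M].
Proof.
move=> P0; have [a [b [ab /dvdpP[Q QE]]]] := dvdp_Xn_sub_Xn P0.
(* The bound a would do for the period; its successor makes M positive. *)
exists a.+1, (b - a)%N; split=> //; first by rewrite subn_gt0.
move=> w Pw n an.
have : shiftop (Q * P) w (n - a) = 0.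
  by rewrite shiftopM (eq_shiftop _ _ Pw) shiftop_seq0.
rewrite -QE shiftopD -scaleN1r shiftopZ !shiftopXn mulN1r => /eqP.
rewrite subr_eq0 => /eqP.
by rewrite subnK ?(ltnW an) // => <-; congr w; lia.
Qed.

Lemma annihilated_periodic (w : nat -> F) :
  annihilated w -> eventuallyPeriodic w.
Proof.
move=> [P P0 Pw]; have [M [N [_ N0 PMN]]] := shiftop_periodic P0.
by exists N, M; split=> //; apply: PMN.
Qed.

End FiniteRecurrence.

(** * Frobenius on Hahn series *)

Section HahnFrobenius.
Variables (F : fieldType) (G : zmodType) (le : totalGroupOrder G).
Local Notation H := (hahn F le).
Local Notation lt a b := (~~ le b a).

Lemma glt_add a b c d : lt a b -> lt c d -> lt (a + c) (b + d).
Proof.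
move=> ab cd; apply: contra ab => bdac.
by rewrite -(gle_add2r le d); apply: gle_trans bdac _; rewrite gle_add2l gnle.
Qed.

Lemma glt_mulrn a b n : lt a b -> lt (a *+ n.+1) (b *+ n.+1).
Proof.
move=> ab; elim: n => [//|n IH].
by rewrite [a *+ _]mulrS [b *+ _]mulrS; apply: glt_add.
Qed.

Lemma gmulrn_inj n : (0 < n)%N -> injective (fun a : G => a *+ n).
Proof.
case: n => // n _ a b /= ab; have [lab|nab] := boolP (le a b).
  have [lba|/(glt_mulrn n)] := boolP (le b a); last by rewrite ab gle_refl.
  by apply: (@gle_anti _ le); rewrite lab.
by have := glt_mulrn n nab; rewrite ab gle_refl.
Qed.

(** R stands for the strict order or its reverse, so that both halves of the splitting in
    [hahn_expp_eq0] are covered. *)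
Lemma hahn_exp_supp (R : G -> G -> Prop) (f : H) m c n :
  (forall a b a' b', R a b -> R a' b' -> R (a + a') (b + b')) ->
  (forall a, f a != 0 -> R (a *+ m) c) ->
  forall b, (f ^+ n.+1) b != 0 -> R (b *+ m) (c *+ n.+1).
Proof.
move=> RD fR; elim: n => [|n IH] b; first exact: fR.
rewrite exprS => /hahnM_neq0[a [fa /IH fb]].
by rewrite mulrS -(subrK a b) addrC mulrnDl; apply: RD => //; apply: fR.
Qed.

Lemma hrestrict_subproof (f : H) (S : pred G) :
  hahn_pred le (fun a => if S a then f a else 0).
Proof.
apply/asboolP => X XS; apply: (@hahn_wo _ _ _ f) => a /XS /=.
by case: (S a) => //; rewrite eqxx.
Qed.

Definition hrestrict (f : H) (S : pred G) : H := Hahn (hrestrict_subproof f S).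

Lemma hrestrictE f S a : hrestrict f S a = if S a then f a else 0.
Proof. by []. Qed.

Lemma hmonoE x a b : hmono le x a b = if b == a then x else 0 :> F.
Proof. by []. Qed.

Lemma hmonoM x y a b :
  (hmono le x a : H) * hmono le y b = hmono le (x * y) (a + b).
Proof.
apply: hahnP => c; rewrite hmonoME !hmonoE subr_eq addrC.
by case: eqP; rewrite ?mulr0.
Qed.

Lemma hmonoX x a n : (hmono le x a : H) ^+ n = hmono le (x ^+ n) (a *+ n).
Proof.
by elim: n => [//|n IH]; rewrite exprS IH hmonoM mulrS exprS.
Qed.

Lemma hahn_natE n a : (n%:R : H) a = (1 : H) a *+ n.
Proof.
elim: n => [//|n IH].
by rewrite [n.+1%:R]mulrS [RHS]mulrS hahnDE IH.
Qed.

Variable p : nat.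
Hypothesis charF : p \in [pchar F].
Let p_prime : prime p. Proof. by case/andP: charF. Qed.
Let p_gt0 : (0 < p)%N. Proof. exact: prime_gt0. Qed.

Lemma pchar_hahn : p \in [pchar H].
Proof.
rewrite inE /= p_prime; apply/eqP/hahnP => a.
by rewrite hahn_natE -mulr_natr (eqP (proj2 (andP charF))) mulr0.
Qed.

Lemma hahn_expDp (f g : H) m : (f + g) ^+ (p ^ m) = f ^+ (p ^ m) + g ^+ (p ^ m).
Proof.
apply: exprDn_pchar; rewrite (eq_pnat _ (pcharf_eq pchar_hahn)).
by rewrite pnatX pnat_id.
Qed.

(* Split f into its parts below and above c / p: every sum of p exponents of the
   first is less than c, and of the second greater than c. *)
Lemma hahn_expp_eq0 (f : H) c :
  (forall b, f b != 0 -> b *+ p != c) -> (f ^+ p) c = 0.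
Proof.
move=> fc; pose f1 := hrestrict f (fun a => lt (a *+ p) c).
pose f2 := hrestrict f (fun a => lt c (a *+ p)).
have fE : f = f1 + f2.
  apply: hahnP => a; rewrite hahnDE !hrestrictE.
  have [/eqP f0|/fc ac] := boolP (f a == 0); first by rewrite f0 !if_same add0r.
  have [l1|l1] := boolP (le c _); have [l2|l2] := boolP (le _ c).
  - by case/eqP: ac; apply: (@gle_anti _ le); rewrite l2.
  - by rewrite add0r.
  - by rewrite addr0.
  - by have := gle_total le c (a *+ p); rewrite (negbTE l1) (negbTE l2).
have pE : p = p.-1.+1 by rewrite prednK.
have := hahn_expDp f1 f2 1; rewrite expn1 -fE => ->; rewrite hahnDE.
rewrite [X in X + _](_ : _ = 0) ?[X in _ + X](_ : _ = 0) ?addr0 //.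
  apply/eqP; apply: contraT; rewrite pE.
  move=> /(@hahn_exp_supp (fun a b => lt b a) _ p c).
  rewrite -pE gle_refl; apply => //; first by move=> *; apply: glt_add.
  by move=> a; rewrite hrestrictE; case: ifP => //; rewrite eqxx.
apply/eqP; apply: contraT; rewrite pE.
move=> /(@hahn_exp_supp (fun a b => lt a b) _ p c).
rewrite -pE gle_refl; apply => //; first by move=> *; apply: glt_add.
by move=> a; rewrite hrestrictE; case: ifP => //; rewrite eqxx.
Qed.

(** Split off the term of f at b. Frobenius is additive, and multiplication by p is injective on
    exponents, so the remaining terms do not reach [b *+ p]. *)
Lemma hahn_expp (f : H) b : (f ^+ p) (b *+ p) = f b ^+ p.
Proof.
pose f' := f - hmono le (f b) b.
have := hahn_expDp (hmono le (f b) b) f' 1; rewrite expn1 addrC subrK => ->.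
rewrite hahnDE hmonoX hmonoE eqxx hahn_expp_eq0 ?addr0 // => a.
apply: contraNneq => /(gmulrn_inj p_gt0) ->.
by rewrite hahnBE hmonoE eqxx subrr.
Qed.

Lemma hahn_exppX (f : H) m b : (f ^+ (p ^ m)) (b *+ p ^ m) = f b ^+ (p ^ m).
Proof.
elim: m => [|m IH]; first by rewrite expn0 mulr1n.
by rewrite !expnSr mulrnA !exprM hahn_expp IH.
Qed.

Lemma hahn_exppX_supp (f : H) m c :
  (f ^+ (p ^ m)) c != 0 -> exists2 b, f b != 0 & c = b *+ p ^ m.
Proof.
elim: m c => [|m IH] c; first by exists c; rewrite ?mulr1n.
rewrite expnSr exprM => fc.
have [/existsNP[b /not_implyP[fb /negP/negPn/eqP bc]]|nb] :=
    pselect (~ forall b, (f ^+ (p ^ m)) b != 0 -> b *+ p != c); last first.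
  by case/eqP: fc; apply: hahn_expp_eq0; apply: contrapT.
have [a fa ab] := IH _ fb; exists a => //.
by rewrite mulrnA -ab.
Qed.

End HahnFrobenius.

(** * Linear relations between powers *)

(** If P of degree D kills u, the residues modulo P of D + 1 powers of X lie in a space of dimension
    D and are therefore dependent. *)
Lemma algebraic_power_relation (K L : fieldType) (iota : {rmorphism K -> L})
    (u : L) (e : nat -> nat) : algebraicOver iota u ->
  exists d (v : 'I_d -> K), (exists k, v k != 0) /\
    \sum_(k < d) iota (v k) * u ^+ e k = 0.
Proof.
move=> [P P0 Pu]; pose D := (size P).-1.
have sP : size P = D.+1 by rewrite prednK // lt0n size_poly_eq0.
pose M : 'M[K]_(D.+1, D) := \matrix_k poly_rV ('X^(e k) %% P).
have : kermx M != 0.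
  rewrite kermx_eq0 /row_free; apply: contraTneq (rank_leq_col M) => ->.
  by rewrite ltnn.
move=> /rowV0Pn[v /sub_kermxP vM v0].
exists D.+1, (v 0); split.
  by have /rV0Pn[k vk] := v0; exists k.
have powE k : u ^+ e k = (map_poly iota ('X^(e k) %% P)).[u].
  have := congr1 (fun Q => (map_poly iota Q).[u]) (divp_eq 'X^(e k) P).
  by rewrite /= rmorphD rmorphM /= hornerD hornerM (rootP Pu) mulr0 add0r map_polyXn hornerXn.
transitivity (map_poly iota (rVpoly (v *m M))).[u]; last first.
  by rewrite vM linear0 rmorph0 horner0.
rewrite mulmx_sum_row linear_sum rmorph_sum horner_sum; apply: eq_bigr => k _.
have sM : (size ('X^(e k) %% P)%R <= D)%N.
  by have := @ltn_modpN0 _ 'X^(e k) P P0; rewrite sP ltnS.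
rewrite powE linearZ /= rowK poly_rV_K //.
by rewrite -mul_polyC rmorphM /= map_polyC hornerM hornerC.
Qed.

(** * Clearing denominators in relations *)

Section FracPowerSeries.
Variables (F : fieldType) (le : totalGroupOrder (rat * rat)%type).
Local Notation H := (hahn F le).
Local Notation K := (fracPowerSeries2 F le).

Lemma common_denominator d (v : 'I_d -> K) :
  exists h : H, [/\ h != 0, h \in @powerSeries2 F le &
    forall k, h * \val (v k) \in @powerSeries2 F le].
Proof.
elim: d v => [|d IH] v.
  by exists 1; rewrite oner_neq0 rpred1; split=> // -[].
have [h [h0 hP hv]] := IH (fun k => v (lift ord0 k)).
have /asboolP[a [b [aP bP b0 ab]]] := valP (v ord0).
exists (h * b); split; [exact: mulf_neq0|exact: rpredM|].
move=> k; case: (unliftP ord0 k) => [j ->|->].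
  rewrite mulrAC; apply: rpredM; [exact: hv|exact: bP].
by rewrite ab -mulrA (mulrC b) divfK //; apply: rpredM.
Qed.

Lemma algebraic_powerSeries2_relation (f : H) (e : nat -> nat) :
  algebraicOver (\val : K -> H) f ->
  exists d (a : 'I_d -> H), [/\ forall k, a k \in @powerSeries2 F le,
    exists k, a k != 0 & \sum_(k < d) a k * f ^+ e k = 0].
Proof.
move=> /(@algebraic_power_relation K H \val f e)[d [v [[k0 v0] vf]]].
have [h [h0 hP hv]] := common_denominator v.
exists d, (fun k => h * \val (v k)); split => //.
  by exists k0; rewrite mulf_neq0 // fmorph_eq0.
transitivity (h * 0); last exact: mulr0.
rewrite -[in RHS]vf mulr_sumr; apply: eq_bigr => k _; exact: esym (mulrA _ _ _).
Qed.

End FracPowerSeries.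

(* With b = true the two variables are exchanged, so that each one-sided argument
   below serves for both variables. *)
Definition swapPair (b : bool) (x y : rat) : rat * rat :=
  if b then (y, x) else (x, y).

Lemma swapPair_inj b x y x' y' :
  swapPair b x y = swapPair b x' y' -> x = x' /\ y = y'.
Proof. by case: b => -[-> ->]. Qed.

Lemma swapPairB b x y x' y' :
  swapPair b x y - swapPair b x' y' = swapPair b (x - x') (y - y').
Proof. by case: b. Qed.

Lemma swapPairD b x y x' y' :
  swapPair b x y + swapPair b x' y' = swapPair b (x + x') (y + y').
Proof. by case: b. Qed.

Lemma swapPairMn b x y n : swapPair b x y *+ n = swapPair b (x *+ n) (y *+ n).
Proof.
elim: n => [|n IH]; first by case: b.
by rewrite mulrS IH swapPairD -!mulrS.
Qed.

(** * Fractional parts of s / p ^ i *)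

Section FracPow.
Variable p : nat.
Hypothesis p_prime : prime p.

Definition fracPow (s i : nat) : rat := s%:R / p%:R ^+ i.

Let p0 : (p%:R : rat) != 0.
Proof. by rewrite pnatr_eq0 -lt0n prime_gt0. Qed.
Let ppos : 0 < (p%:R : rat). Proof. by rewrite ltr0n prime_gt0. Qed.

Lemma fracPowMn s i K : fracPow s (i + K) *+ p ^ K = fracPow s i.
Proof.
by rewrite -mulr_natr natrX /fracPow exprD invfM mulrA divfK // expf_neq0.
Qed.

Lemma fracPow0 s : fracPow s 0 = s%:R.
Proof. by rewrite /fracPow expr0 divr1. Qed.

Lemma fracPow_ge0 s i : 0 <= fracPow s i.
Proof. by rewrite divr_ge0 ?ler0n // exprn_ge0 // ltW. Qed.

Lemma fracPow_gt0 s i : (0 < s)%N -> 0 < fracPow s i.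
Proof. by move=> s0; rewrite divr_gt0 ?ltr0n // exprn_gt0. Qed.

Lemma fracPow_lt1 s i : (s < p)%N -> (0 < i)%N -> fracPow s i < 1.
Proof.
move=> sp i0; rewrite ltr_pdivrMr ?exprn_gt0 // mul1r -natrX ltr_nat.
by apply: leq_trans sp _; rewrite -{1}(expn1 p) leq_exp2l // prime_gt1.
Qed.

Lemma fracPow_lt s i j : (0 < s)%N -> (i < j)%N -> fracPow s j < fracPow s i.
Proof.
move=> s0 ij; rewrite ltr_pM2l ?ltr0n // ltf_pV2 ?posrE ?exprn_gt0 //.
by rewrite ltr_eXn2l // ltr1n prime_gt1.
Qed.

Lemma fracPow_inj s : (0 < s)%N -> injective (fracPow s).
Proof.
move=> s0 i j eij; case: (ltngtP i j) => [/(fracPow_lt s0)|/(fracPow_lt s0)|//];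
  by rewrite eij ltxx.
Qed.

(* The fractional parts of s / p ^ i and p ^ K * (s / p ^ i') agree only if the
   two numbers are equal, since s / p ^ i lies in [0, 1). *)
Lemma fracPow_nat_diff s i i' K (m u : nat) : (s < p)%N -> (0 < i)%N ->
  - fracPow s i + u%:R + fracPow s i' *+ p ^ K = m%:R -> m = u.
Proof.
move=> sp i0; have [->|s0] := posnP s.
  by rewrite /fracPow !mul0r mul0rn oppr0 add0r addr0 => /eqP; rewrite eqr_nat => /eqP.
have x0 := fracPow_gt0 i s0; have x1 := fracPow_lt1 sp i0.
have natlt (a b : nat) : (a%:R : rat) < b%:R + 1 -> (a <= b)%N.
  by rewrite -[1](mulr1n) -natrD ltr_nat addn1 ltnS.
(* If i' <= K, the multiple of s / p ^ i' is an integer, which would make s / p ^ i an integer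
   strictly between 0 and 1. Otherwise it equals s / p ^ (i' - K), and m - u is a difference of two
   numbers in [0, 1). *)
have [iK|Ki] := leqP i' K.
  rewrite -{1}(subnKC iK) expnD mulrnA -{1}[i']add0n fracPowMn fracPow0 => E.
  exfalso.
  have E' : - fracPow s i + (u + s * p ^ (K - i'))%N%:R = m%:R.
    by rewrite -E natrD natrM addrA mulr_natr.
  have : (m < u + s * p ^ (K - i'))%N by rewrite -(ltr_nat rat) -E'; lra.
  by rewrite ltnNge => /negP; apply; apply: natlt; lra.
rewrite -{1}(subnK (ltnW Ki)) fracPowMn => E.
have y0 := fracPow_ge0 s (i' - K); have y1 : fracPow s (i' - K) < 1.
  by apply: fracPow_lt1; rewrite ?subn_gt0.
apply/eqP; rewrite eqn_leq; apply/andP; split; apply: natlt; lra.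
Qed.

End FracPow.

(** * From algebraicity to periodicity *)

Section Forward.
Variables (p : nat) (F : finFieldType).
Hypothesis charF : p \in [pchar F].
Let p_prime : prime p. Proof. by case/andP: charF. Qed.
Variable le : totalGroupOrder (rat * rat)%type.
Local Notation H := (hahn F le).
Local Notation K := (fracPowerSeries2 F le).

Variables (b : bool) (s1 s2 : nat).
Hypotheses (s1p : (s1 < p)%N) (s2p : (s2 < p)%N).

Local Notation r := (fracPow p).

(** For b = false this is [negExponent]; for b = true it becomes [negExponent] once s1, s2 and the
    indices i, j are exchanged too. *)
Definition swapExponent i j := swapPair b (- r s1 i) (- r s2 j).

Variable f : H.
Hypothesis supp_f : forall a, f a != 0 ->
  exists i j : nat, [/\ (0 < i)%N, (0 < j)%N & a = swapExponent i j].

Lemma powerSeries2_swap (a : H) c : a \in @powerSeries2 F le -> a c != 0 ->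
  exists m n : nat, c = swapPair b m%:R n%:R.
Proof.
move=> /asboolP aP /aP[m [n ->]].
by case: b; [exists n, m|exists m, n].
Qed.

Lemma swapExponentMn i j k :
  swapExponent (i + k) (j + k) *+ p ^ k = swapExponent i j.
Proof. by rewrite swapPairMn !mulNrn !fracPowMn. Qed.

(** The fractional parts of both coordinates force the term of a to be the one at (u, v), by
    [fracPow_nat_diff]. *)
Lemma relation_diagonal (a : H) i j u v k :
  a \in @powerSeries2 F le -> (0 < i)%N -> (0 < j)%N ->
  (a * f ^+ (p ^ k)) (swapPair b (u%:R - r s1 i) (v%:R - r s2 j)) =
  a (swapPair b u%:R v%:R) * f (swapExponent (i + k) (j + k)) ^+ (p ^ k).
Proof.
move=> aP i0 j0.
rewrite (@hahnME _ _ _ _ _ _ [:: swapPair b u%:R v%:R]) ?big_seq1 //.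
  rewrite swapPairB ![_%:R - _]addrC !addrK.
  by rewrite -(hahn_exppX charF) swapExponentMn.
move=> c /(powerSeries2_swap aP)[m [n ->]] /(hahn_exppX_supp charF)[d].
move=> /supp_f[i' [j' [_ _ ->]]]; rewrite swapPairB swapPairMn !mulNrn.
move=> /swapPair_inj[E1 E2]; rewrite inE.
rewrite (@fracPow_nat_diff p p_prime s1 i i' k m u) //; last first.
  by move/eqP: E1; rewrite subr_eq addrC; move/eqP=> E; lra.
rewrite (@fracPow_nat_diff p p_prime s2 j j' k n v) //.
by move/eqP: E2; rewrite subr_eq addrC; move/eqP=> E; lra.
Qed.

(* Modulo integers, - s1 / p ^ i is not hit by any other row, so that only the
   row i + k of f contributes. *)
Lemma relation_row (a : H) i u w k J :
  a \in @powerSeries2 F le -> (0 < i)%N -> (0 < s2)%N ->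
  (forall j, (J < j)%N -> a (swapPair b u%:R (w + r s2 j *+ p ^ k)) = 0) ->
  (a * f ^+ (p ^ k)) (swapPair b (u%:R - r s1 i) w) =
  \sum_(j <- iota 1 J) a (swapPair b u%:R (w + r s2 j *+ p ^ k)) *
    f (swapExponent (i + k) j) ^+ (p ^ k).
Proof.
move=> aP i0 s20 aJ.
rewrite (@hahnME _ _ _ _ _ _
  [seq swapPair b u%:R (w + r s2 j *+ p ^ k) | j <- iota 1 J]).
- rewrite big_map; apply: eq_bigr => j _; congr (_ * _).
  rewrite -(hahn_exppX charF); congr (_ _).
  rewrite swapPairB swapPairMn !mulNrn fracPowMn //.
  by rewrite [u%:R - _]addrC addrK opprD addNKr.
- rewrite map_inj_uniq ?iota_uniq // => j j' /swapPair_inj[_ /addrI].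
  have pk0 : (0 < p ^ k)%N by rewrite expn_gt0 prime_gt0.
  by move=> /(pmulrnI pk0)/(fracPow_inj p_prime s20).
move=> c ac; have [m [n cE]] := powerSeries2_swap aP ac; rewrite cE in ac *.
move=> /(hahn_exppX_supp charF)[d].
move=> /supp_f[i' [j' [_ j'0 ->]]]; rewrite swapPairB swapPairMn !mulNrn.
move=> /swapPair_inj[E1 E2].
have mE : m = u.
  apply: (@fracPow_nat_diff p p_prime s1 i i' k m u) => //; lra.
have nE : n%:R = w + r s2 j' *+ p ^ k by lra.
rewrite {}mE nE in ac *; apply/mapP; exists j' => //.
rewrite mem_iota add1n ltnS j'0 leqNgt; apply: contraNN ac => Jj.
by rewrite aJ.
Qed.

Lemma hahn_sumE (I : Type) (t : seq I) (g : I -> H) c :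
  (\sum_(i <- t) g i) c = \sum_(i <- t) g i c.
Proof.
elim: t => [|i t IH]; first by rewrite !big_nil.
by rewrite !big_cons hahnDE IH.
Qed.

(** * Recurrences extracted from a relation between powers *)

Variable e : nat.
Hypotheses (e0 : (0 < e)%N) (cardF : #|F| = (p ^ e)%N).

Lemma expf_cardX (x : F) k : x ^+ (p ^ (e * k)) = x.
Proof.
elim: k => [|k IH]; first by rewrite muln0 expn0 expr1.
by rewrite mulnS expnD exprM -cardF expf_card IH.
Qed.

Variables (d : nat) (a : 'I_d -> H).
Hypothesis aP : forall k, a k \in @powerSeries2 F le.
Hypothesis a_neq0 : exists k, a k != 0.
Hypothesis relation : \sum_(k < d) a k * f ^+ (p ^ (e * k)) = 0.

Lemma relation_coef : exists k (u v : nat), a k (swapPair b u%:R v%:R) != 0.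
Proof.
have [k /hahn_lead[c ac _]] := a_neq0; exists k.
have [u [v cE]] := powerSeries2_swap (aP k) ac.
by exists u, v; rewrite -cE.
Qed.

(* The polynomial of the recurrence with steps of length e. *)
Definition symbol (c : 'I_d -> F) : {poly F} := \sum_(k < d) c k *: 'X^(e * k).

Lemma symbol_neq0 c : (exists k, c k != 0) -> symbol c != 0.
Proof.
move=> [k ck]; apply: contraNneq ck => /(congr1 (fun P : {poly F} => P`_(e * k))).
rewrite coef0 coef_sum (bigD1 k) //= coefZ coefXn eqxx mulr1.
rewrite big1 ?addr0 => [->//|k' /negbTE kk'].
by rewrite coefZ coefXn eqn_pmul2l // eq_sym -val_eqE /= in kk' *; rewrite kk' mulr0.
Qed.

Lemma shiftop_symbol c w n :
  shiftop (symbol c) w n = \sum_(k < d) c k * w (n + e * k)%N.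
Proof.
by rewrite shiftop_sum; apply: eq_bigr => k _; rewrite shiftopZ shiftopXn.
Qed.

Lemma relation_periodic : exists M N : nat, [/\ (0 < M)%N, (0 < N)%N &
  forall i0 j0 : nat, (0 < i0)%N -> (0 < j0)%N ->
    periodicAfter (fun n => f (swapExponent (i0 + n) (j0 + n))) N M].
Proof.
have [k [u [v kuv]]] := relation_coef.
have C0 : symbol (fun k => a k (swapPair b u%:R v%:R)) != 0.
  by apply: symbol_neq0; exists k.
have [M [N [M0 N0 MN]]] := shiftop_periodic C0.
exists M, N; split=> // i0 j0 i00 j00; apply: MN => n.
(* The recurrence is the coefficient of the relation at this exponent; its coefficients do not
   involve i0, j0 or n. *)
rewrite shiftop_symbol -[RHS](@hahn0E F _ le
  (swapPair b (u%:R - r s1 (i0 + n)) (v%:R - r s2 (j0 + n)))).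
rewrite -relation hahn_sumE; apply: eq_bigr => k' _.
by rewrite relation_diagonal ?addn_gt0 ?i00 ?j00 // expf_cardX !addnA.
Qed.

(* With w minimal, the columns beyond j do not contribute to the coefficient at w,
   and the recurrence for column j is nonzero; the columns before j are annihilated by
   induction. *)
Lemma relation_annihilated j : (0 < s1)%N -> (0 < s2)%N -> (0 < j)%N ->
  annihilated (fun n => f (swapExponent n.+1 j)).
Proof.
move=> s10 s20; have [k0 [u [v0 kuv]]] := relation_coef.
elim/ltn_ind: j => j IH j0.
have pj0 : (p%:R ^+ j : rat) != 0.
  by rewrite expf_neq0 // pnatr_eq0 -lt0n prime_gt0.
(* The value n - s2 q^k / p^j, with q = p^e, scaled by p^j and translated by s2 q^d, is a natural
   number; hence a minimum exists. *)
pose weight (k : 'I_d) n := (n * p ^ j + s2 * (p ^ (e * d) - p ^ (e * k)))%N.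
have weightE k n : (weight k n)%:R =
    (n%:R - r s2 j *+ p ^ (e * k)) * p%:R ^+ j + (s2 * p ^ (e * d))%N%:R :> rat.
  rewrite /weight mulnBr natrD natrB; last first.
    by rewrite leq_mul2l leq_exp2l ?prime_gt1 // leq_mul2l (ltnW (ltn_ord k)) !orbT.
  have E : r s2 j *+ p ^ (e * k) * p%:R ^+ j = (s2 * p ^ (e * k))%N%:R.
    by rewrite -[r s2 j *+ _]mulr_natr mulrAC divfK // -natrM.
  by rewrite mulrBl E [(n * _)%N%:R]natrM natrX addrAC addrA.
pose good m := `[< exists k n, a k (swapPair b u%:R n%:R) != 0 /\ weight k n = m >].
have ex_good : exists m, good m.
  by exists (weight k0 v0); apply/asboolP; exists k0, v0.
case: (ex_minnP ex_good) => m /asboolP[k1 [n1 [a1 m1]]] mmin.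
pose w : rat := n1%:R - r s2 j *+ p ^ (e * k1).
have wmin k n : a k (swapPair b u%:R n%:R) != 0 -> w <= n%:R - r s2 j *+ p ^ (e * k).
  move=> akn; have /mmin : good (weight k n) by apply/asboolP; exists k, n.
  rewrite -m1 -(ler_nat rat) !weightE lerD2r ler_pM2r //.
  by rewrite exprn_gt0 // ltr0n prime_gt0.
pose c j' (k : 'I_d) := a k (swapPair b u%:R (w + r s2 j' *+ p ^ (e * k))).
(* A nonzero coefficient in a later column j' would give the value w - (s2 / p^j - s2 / p^j') q^k,
   which is below the minimum w. *)
have c_eq0 j' k : (j < j')%N -> c j' k = 0.
  move=> jj'; apply/eqP; apply: contraT => cjk.
  have [u' [n]] := powerSeries2_swap (aP k) cjk.
  move=> /swapPair_inj[_ nE]; have := cjk; rewrite /c nE => /wmin.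
  rewrite -nE -addrA lerDl subr_ge0 lerMn2r leNgt fracPow_lt // orbF.
  by rewrite expn_eq0 eqn0Ngt prime_gt0.
pose column j' n := f (swapExponent n.+1 j').
have rel n : \sum_(j' <- iota 1 j) shiftop (symbol (c j')) (column j') n = 0.
  rewrite -[RHS](@hahn0E F _ le (swapPair b (u%:R - r s1 n.+1) w)) -relation hahn_sumE.
  rewrite (eq_bigr _ (fun j' _ => shiftop_symbol _ _ _)) exchange_big.
  apply: eq_bigr => k _; rewrite (@relation_row _ _ _ _ _ j) //; last first.
    by move=> j' /(c_eq0 _ k).
  by apply: eq_bigr => j' _; rewrite expf_cardX.
(* At k1, where the minimum is attained, the coefficient for column j is the nonzero one at (u,
   n1). *)
have cj0 : symbol (c j) != 0.
  apply: symbol_neq0; exists k1; rewrite /c /w subrK.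
  exact: a1.
apply: (annihilated_shiftop cj0); apply: annihilatedN.
have jE : iota 1 j = rcons (iota 1 j.-1) j.
  by case: (j) j0 => // j'' _; rewrite -[X in iota 1 X = _]addn1 iotaD cats1 add1n.
pose v n := \sum_(j' <- iota 1 j.-1) shiftop (symbol (c j')) (column j') n.
have vE : v = (fun n => - shiftop (symbol (c j)) (column j) n).
  apply/funext => n; apply/eqP; rewrite -addr_eq0; apply/eqP.
  by rewrite -(rel n) jE -cats1 big_cat big_seq1.
rewrite -vE; apply: annihilated_sum => j'; rewrite mem_iota => /andP[j'0 j'j].
by apply: annihilated_shiftopr; apply: IH => //; lia.
Qed.

End Forward.

(** * From periodicity to algebraicity *)

Section Backward.
Variables (p : nat) (F : finFieldType).
Hypothesis charF : p \in [pchar F].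
Let p_prime : prime p. Proof. by case/andP: charF. Qed.
Variable le : totalGroupOrder (rat * rat)%type.
Local Notation H := (hahn F le).
Local Notation K := (fracPowerSeries2 F le).
Local Notation algebraic h := (algebraicOver (\val : K -> H) h).
Local Notation r := (fracPow p).

Lemma algebraic_frac (h : H) : h \in @fracPowerSeries2_pred F le -> algebraic h.
Proof.
by move=> hP; have := algebraic_id (\val : K -> H) (FracPowerSeries2 hP).
Qed.

Lemma hmono_powerSeries2 (x : F) (m n : nat) :
  hmono le x (m%:R, n%:R) \in @powerSeries2 F le.
Proof.
apply/asboolP => c; rewrite hmonoE.
by have [->|_] := eqVneq c (m%:R, n%:R); [exists m, n | rewrite eqxx].
Qed.

Lemma algebraic_hmono_nat (x : F) (m n : nat) : algebraic (hmono le x (m%:R, n%:R)).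
Proof.
apply: algebraic_frac; apply/asboolP.
exists (hmono le x (m%:R, n%:R)), 1; rewrite divr1 oner_neq0 rpred1.
by split=> //; apply: hmono_powerSeries2.
Qed.

Lemma algebraicX (h : H) n : algebraic h -> algebraic (h ^+ n).
Proof.
move=> ha; elim: n => [|n IH]; first exact: algebraic1.
by rewrite exprS; apply: algebraic_mul.
Qed.

(** The polynomial X^n - (mu X + nu) is monic because n > 1, and its coefficients are integral over
    the base field. *)
Lemma algebraic_affine_power (h mu nu : H) n : (1 < n)%N ->
  algebraic mu -> algebraic nu -> h ^+ n = mu * h + nu -> algebraic h.
Proof.
move=> n1 /integral_algebraic amu /integral_algebraic anu hE.
apply/integral_algebraic; pose P : {poly H} := 'X^n - (mu *: 'X + nu%:P).
have sP : (size (mu *: 'X + nu%:P : {poly H})%R < n.+1)%N.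
  apply: leq_trans (n1 : (2 < n.+1)%N); rewrite ltnS -mul_polyC size_MXaddC.
  by case: ifP => // _; rewrite ltnS size_polyC leq_b1.
have mP : P \is monic.
  by rewrite monicE lead_coefDl ?lead_coefXn // size_polyN size_polyXn.
apply: (integral_root_monic mP).
  by rewrite /root !hornerE hE subrr.
apply/integral_poly => i; rewrite !(coefB, coefD) coefXn coefZ coefX coefC.
apply: integral_sub; first exact: integral_nat.
apply: integral_add; first by apply: integral_mul => //; apply: integral_nat.
by case: eqP => _ //; apply: integral0.
Qed.

Lemma algebraic_hmono_mulrn (a : rat * rat) n : (0 < n)%N ->
  algebraic (hmono le (1 : F) (a *+ n)) -> algebraic (hmono le (1 : F) a).
Proof.
(* The exponent is doubled because n may be 1, whereas [algebraic_affine_power] asks for an exponent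
   above 1. *)
move=> n0 aan; have n2 : (1 < n + n)%N by lia.
apply: (@algebraic_affine_power _ 0 (hmono le 1 (a *+ n) ^+ 2) (n + n)) => //.
- exact: algebraic0.
- exact: algebraicX.
by rewrite mul0r add0r !hmonoX !expr1n -mulrnA muln2 addnn.
Qed.

Lemma algebraic_hmonoN (a : rat * rat) :
  algebraic (hmono le (1 : F) (- a)) -> algebraic (hmono le (1 : F) a).
Proof.
move=> /algebraic_inv.
suff -> : hmono le (1 : F) a = (hmono le (1 : F) (- a) : H)^-1 by [].
apply: (@mulIf _ (hmono le 1 (- a) : H)).
  apply/eqP => /(congr1 (fun f : H => f (- a))).
  by rewrite hmonoE eqxx => /eqP; rewrite oner_eq0.
rewrite hmonoM subrr mulr1 mulVf //.
apply/eqP => /(congr1 (fun f : H => f (- a))).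
by rewrite hmonoE eqxx => /eqP; rewrite oner_eq0.
Qed.

(** Multiplying the exponent by - p ^ (i + j) clears its denominators and signs, which leads to a
    monomial of the power series ring. *)
Lemma algebraic_hmono b s1 s2 i j (x : F) :
  algebraic (hmono le x (swapExponent p b s1 s2 i j)).
Proof.
have -> : hmono le x (swapExponent p b s1 s2 i j) =
    hmono le x (0%:R, 0%:R) * hmono le 1 (swapExponent p b s1 s2 i j) :> H.
  by rewrite hmonoM mulr1 add0r.
apply: algebraic_mul; first exact: algebraic_hmono_nat.
apply: (@algebraic_hmono_mulrn _ (p ^ (i + j))).
  by rewrite expn_gt0 prime_gt0.
apply: algebraic_hmonoN.
have r0 s k : r s k *+ p ^ k = s%:R.
  by rewrite -[X in fracPow _ _ X]add0n fracPowMn // fracPow0.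
have -> : - (swapExponent p b s1 s2 i j *+ p ^ (i + j)) =
    swapPair b (s1 * p ^ j)%N%:R (s2 * p ^ i)%N%:R.
  rewrite swapPairMn -sub0r.
  rewrite (_ : 0 = swapPair b 0 0) ?swapPairB; last by case: b.
  rewrite !sub0r !mulNrn !opprK; congr swapPair.
    by rewrite expnD mulrnA r0 -mulrnA.
  by rewrite addnC expnD mulrnA r0 -mulrnA.
by case: b; apply: algebraic_hmono_nat.
Qed.

(** * Algebraicity of rows, columns and arrays *)

Variable e : nat.
Hypotheses (e0 : (0 < e)%N) (cardF : #|F| = (p ^ e)%N).

Lemma periodicAfterM (T : Type) (w : nat -> T) N M k :
  periodicAfter w N M -> periodicAfter w (k * N) M.
Proof.
move=> wN; elim: k => [|k IH] n nM; first by rewrite addn0.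
by rewrite mulSn addnA IH ?wN // (leq_trans nM) // leq_addr.
Qed.

(** Any two tails differ by an algebraic series, so [tail B] may be replaced by [tail B'] plus such
    a series; this leaves an affine power equation for [tail B']. *)
Lemma algebraic_tails (tail : nat -> H) (mu : H) B B' n :
  (1 < n)%N -> algebraic mu -> (forall B, algebraic (tail B - tail B.+1)) ->
  tail B' ^+ n = mu * tail B -> algebraic (tail 0).
Proof.
move=> n1 amu astep tailE.
have adiff C : algebraic (tail 0 - tail C).
  elim: C => [|C IH]; first by rewrite subrr; apply: algebraic0.
  by rewrite -(subrK (tail C) (tail 0)) -addrA; apply: algebraic_add.
have atail : algebraic (tail B').
  apply: (@algebraic_affine_power _ mu
    (mu * ((tail 0 - tail B') - (tail 0 - tail B))) n) => //.
    by apply: algebraic_mul => //; apply: algebraic_sub.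
  by rewrite tailE -mulrDr; congr (_ * _); ring.
by rewrite -(subrK (tail B') (tail 0)); apply: algebraic_add.
Qed.

Lemma swapExponent_inj b s1 s2 i j i' j' : (0 < s1)%N -> (0 < s2)%N ->
  swapExponent p b s1 s2 i j = swapExponent p b s1 s2 i' j' -> i = i' /\ j = j'.
Proof.
move=> s10 s20 /swapPair_inj[/oppr_inj/(fracPow_inj p_prime s10) ->].
by move=> /oppr_inj/(fracPow_inj p_prime s20) ->.
Qed.

Lemma expp_gt1 N : (0 < N)%N -> (1 < p ^ (e * N))%N.
Proof.
by move=> N0; rewrite -[1%N](exp1n (e * N)) ltn_exp2r ?muln_gt0 ?e0 // prime_gt1.
Qed.

Lemma algebraic_row b s1 s2 i (h : H) : (0 < s2)%N ->
  (forall a, h a != 0 -> exists2 j, (0 < j)%N & a = swapExponent p b s1 s2 i j) ->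
  eventuallyPeriodic (fun j => h (swapExponent p b s1 s2 i j)) -> algebraic h.
Proof.
set E := swapExponent p b s1 s2 => s20 supp_h [N [M [N0 hN]]].
have E_inj j j' : E i j = E i j' -> j = j'.
  by move=> /swapPair_inj[_ /oppr_inj/(fracPow_inj p_prime s20)].
pose tail B := hrestrict h (fun a => `[< exists2 j, (B < j)%N & a = E i j >]).
have tailE B j : tail B (E i j) = if (B < j)%N then h (E i j) else 0.
  rewrite hrestrictE; congr (if _ then _ else _); apply/asboolP/idP.
    by move=> [j' Bj' /E_inj ->].
  by exists j.
have tail_supp B a : tail B a != 0 -> exists2 j, (B < j)%N & a = E i j.
  by rewrite hrestrictE; case: asboolP => // _; rewrite eqxx.
have -> : h = tail 0%N.
  apply: hahnP => a; have [h0|/supp_h[j j0 ->]] := eqVneq (h a) 0.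
    by rewrite hrestrictE h0 if_same.
  by rewrite tailE j0.
(* T is a multiple of the period N, and Q is a power of the cardinality of F, so that the Q-th power
   fixes coefficients. *)
pose T := (e * N)%N; pose Q := (p ^ T)%N.
have Q0 : (0 < Q)%N by rewrite expn_gt0 prime_gt0.
(* The Q-th power shifts j by T but also multiplies the fixed coordinate - s1 / p ^ i by Q; the
   monomial at [delta] accounts for this. *)
pose delta := swapPair b (- r s1 i *+ Q.-1) 0.
have deltaE j : E i (j + T)%N *+ Q - delta = E i j.
  rewrite swapPairMn swapPairB !mulNrn fracPowMn // subr0; congr swapPair.
  by rewrite -{1}(prednK Q0) mulrSr; ring.
apply: (@algebraic_tails tail (hmono le 1 delta) M (M + T)%N Q).
- exact: expp_gt1.
- have -> : hmono le 1 delta = hmono le 1 (swapExponent p b s1 0 i 0) ^+ Q.-1 :> H.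
    rewrite hmonoX expr1n swapPairMn /fracPow mul0r oppr0 mul0rn; congr hmono.
  by apply: algebraicX; apply: algebraic_hmono.
- move=> B; have -> : tail B - tail B.+1 = hmono le (h (E i B.+1)) (E i B.+1).
    apply: hahnP => a; rewrite hahnBE hmonoE.
    have [->|aB] := eqVneq a (E i B.+1).
      by rewrite !tailE ltnn ltnSn subr0.
    apply/eqP; rewrite subr_eq0; apply/eqP; rewrite !hrestrictE.
    congr (if _ then _ else _); apply/asboolP/asboolP => -[j Bj aE]; exists j => //.
      rewrite ltn_neqAle Bj andbT; apply: contra_neq aB => BE.
      by rewrite aE BE.
    exact: ltnW.
  exact: algebraic_hmono.
apply: hahnP => c; rewrite hmonoME mul1r.
have [[j Mj ->]|nj] := pselect (exists2 j, (M < j)%N & c = E i (j + T)%N *+ Q).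
  rewrite (hahn_exppX charF) deltaE !tailE ltn_add2r Mj (expf_cardX cardF).
  by rewrite (periodicAfterM e hN) // ltnW.
have /eqP-> : (tail (M + T)%N ^+ Q) c == 0.
  apply: contraT => /(hahn_exppX_supp charF)[a /tail_supp[j MTj ->] cE].
  case: nj; exists (j - T)%N; first by lia.
  by rewrite subnK //; lia.
symmetry; apply/eqP; apply: contraT => /tail_supp[j Mj cE]; case: nj.
by exists j => //; rewrite -[LHS](subrK delta) cE -(deltaE j) subrK.
Qed.

Lemma eventuallyPeriodic_eq (T : Type) (w w' : nat -> T) M0 :
  (forall n, (M0 <= n)%N -> w n = w' n) ->
  eventuallyPeriodic w -> eventuallyPeriodic w'.
Proof.
move=> ww' [N [M [N0 wN]]]; exists N, (maxn M0 M); split=> // n.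
rewrite geq_max => /andP[M0n Mn]; rewrite -!ww' ?wN //.
by rewrite (leq_trans M0n) // leq_addr.
Qed.

(** Consecutive tails differ by part of a row and part of a column, both algebraic by
    [algebraic_row]; diagonal periodicity makes the Q-th power of [tail (M + T)] equal to
    [tail M]. *)
Lemma algebraic_array s1 s2 (f : H) N M : (0 < s1)%N -> (0 < s2)%N -> (0 < N)%N ->
  let E := swapExponent p false s1 s2 in
  (forall a, f a != 0 -> exists i j, [/\ (0 < i)%N, (0 < j)%N & a = E i j]) ->
  (forall i0 j0, (0 < i0)%N -> (0 < j0)%N ->
    periodicAfter (fun n => f (E (i0 + n)%N (j0 + n)%N)) N M) ->
  (forall i, (0 < i)%N -> eventuallyPeriodic (fun n => f (E i n))) ->
  (forall j, (0 < j)%N -> eventuallyPeriodic (fun n => f (E n j))) ->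
  algebraic f.
Proof.
move=> s10 s20 N0 E supp_f fN f_row f_col.
have E_inj i j i' j' : E i j = E i' j' -> i = i' /\ j = j'.
  exact: swapExponent_inj.
pose tail B := hrestrict f
  (fun a => `[< exists i j, [/\ (B < i)%N, (B < j)%N & a = E i j] >]).
have tailE B i j : tail B (E i j) = if (B < i)%N && (B < j)%N then f (E i j) else 0.
  rewrite hrestrictE; congr (if _ then _ else _); apply/asboolP/andP.
    by move=> [i' [j' [Bi' Bj' /E_inj[-> ->]]]].
  by move=> [Bi Bj]; exists i, j.
have tail_supp B a : tail B a != 0 -> exists i j, [/\ (B < i)%N, (B < j)%N & a = E i j].
  by rewrite hrestrictE; case: asboolP => // _; rewrite eqxx.
have -> : f = tail 0%N.
  apply: hahnP => a; have [f0|/supp_f[i [j [i0 j0 ->]]]] := eqVneq (f a) 0.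
    by rewrite hrestrictE f0 if_same.
  by rewrite tailE i0 j0.
pose T := (e * N)%N; pose Q := (p ^ T)%N.
have EMn i j : E (i + T)%N (j + T)%N *+ Q = E i j := swapExponentMn charF _ _ _ i j T.
apply: (@algebraic_tails tail 1 M (M + T)%N Q).
- exact: expp_gt1.
- exact: algebraic1.
(* The corner (B + 1, B + 1) is counted in [row] only; [col] starts one step further. *)
- move=> B; pose row := hrestrict f (fun a => `[< exists2 j, (B < j)%N & a = E B.+1 j >]).
  pose col := hrestrict f (fun a => `[< exists2 i, (B.+1 < i)%N & a = E i B.+1 >]).
  have rowE i j : row (E i j) = if (i == B.+1) && (B < j)%N then f (E i j) else 0.
    rewrite hrestrictE; congr (if _ then _ else _); apply/asboolP/andP.
      by move=> [j' Bj' /E_inj[-> ->]].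
    by move=> [/eqP-> Bj]; exists j.
  have colE i j : col (E i j) = if (B.+1 < i)%N && (j == B.+1) then f (E i j) else 0.
    rewrite hrestrictE; congr (if _ then _ else _); apply/asboolP/andP.
      by move=> [i' Bi' /E_inj[-> ->]].
    by move=> [Bi /eqP->]; exists i.
  have -> : tail B - tail B.+1 = row + col.
    apply: hahnP => a; rewrite hahnBE hahnDE.
    have [f0|/supp_f[i [j [_ _ ->]]]] := eqVneq (f a) 0.
      by rewrite !hrestrictE f0 !if_same subr0 addr0.
    rewrite !tailE rowE colE.
    case: (ltngtP B.+1 i) => [Bi|iB|<-]; case: (ltngtP B.+1 j) => [Bj|jB|<-];
      rewrite ?ltnn ?(ltnW Bi) ?(ltnW Bj) ?ltnSn /= ?andbF ?andbT ?subrr ?subr0 ?addr0 ?add0r //.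
  apply: algebraic_add.
    apply: (@algebraic_row false s1 s2 B.+1 row) => //.
      move=> a; rewrite hrestrictE; case: asboolP => [[j Bj ->] _|_]; last by rewrite eqxx.
      by exists j => //; apply: leq_ltn_trans Bj.
    apply: (@eventuallyPeriodic_eq _ _ _ B.+1) (f_row B.+1 isT) => n Bn.
    by rewrite rowE eqxx Bn.
  apply: (@algebraic_row true s2 s1 B.+1 col) => //.
    move=> a; rewrite hrestrictE; case: asboolP => [[i Bi ->] _|_]; last by rewrite eqxx.
    by exists i => //; apply: leq_ltn_trans Bi.
  apply: (@eventuallyPeriodic_eq _ _ _ B.+2) (f_col B.+1 isT) => n Bn.
  by rewrite [RHS]colE eqxx Bn.
apply: hahnP => c; rewrite mul1r.
have [[i [j [Mi Mj ->]]]|nij] := pselect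
    (exists i j, [/\ (M < i)%N, (M < j)%N & c = E (i + T)%N (j + T)%N *+ Q]).
  rewrite (hahn_exppX charF) EMn !tailE !ltn_add2r Mi Mj (expf_cardX cardF).
  (* The diagonal is started M steps before (i, j), so that (i, j) is its term of index M. *)
  have := periodicAfterM e (fN (i - M)%N (j - M)%N _ _) (leqnn M).
  by rewrite !addnA !subnK ?(ltnW Mi) ?(ltnW Mj) //; apply; rewrite subn_gt0.
have /eqP-> : (tail (M + T)%N ^+ Q) c == 0.
  apply: contraT => /(hahn_exppX_supp charF)[a /tail_supp[i [j [MTi MTj ->]]] cE].
  case: nij; exists (i - T)%N, (j - T)%N; split; [by lia|by lia|].
  by rewrite !subnK //; lia.
symmetry; apply/eqP; apply: contraT => /tail_supp[i [j [Mi Mj cE]]]; case: nij.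
by exists i, j; split=> //; rewrite cE EMn.
Qed.

End Backward.

(** * The equivalence, including vanishing s1 or s2 *)

Lemma card_finField_expn p (F : finFieldType) : p \in [pchar F] ->
  exists2 e, (0 < e)%N & #|F| = (p ^ e)%N.
Proof.
move=> charF; have [n cardF] : exists n, #|F| = (p ^ n)%N.
  by eexists; apply: (card_pprimeChar charF).
exists n => //; rewrite lt0n; apply: contraTneq (finNzRing_gt1 F).
by rewrite cardF => ->.
Qed.

Lemma eventuallyPeriodic_const (T : Type) (x : T) : eventuallyPeriodic (fun=> x).
Proof. by exists 1%N, 0%N. Qed.

Lemma eventuallyPeriodic_succ (T : Type) (w : nat -> T) :
  eventuallyPeriodic (fun n => w n.+1) -> eventuallyPeriodic w.
Proof. by move=> [N [M [N0 wN]]]; exists N, M.+1; split=> // -[//|n] /wN. Qed.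

Theorem corollary3p7 (p : nat) (p_prime : prime p) (F : finFieldType)
    (charF : p \in [pchar F]) (s1 s2 : 'I_p)
    (le : totalGroupOrder (rat * rat)%type)
    (le10 : le 0 (1, 0)) (le01 : le 0 (0, 1))
    (f : hahn F le)
    (supp_f : forall a : rat * rat, f a != 0 ->
       exists i j : nat, [/\ (0 < i)%N, (0 < j)%N & a = negExponent p s1 s2 i j]) :
  algebraicOver (\val : fracPowerSeries2 F le -> hahn F le) f <->
  (exists M N : nat, [/\ (0 < M)%N, (0 < N)%N &
     forall i0 j0 : nat, (0 < i0)%N -> (0 < j0)%N ->
       periodicAfter (fun n => f (negExponent p s1 s2 (i0 + n) (j0 + n))) N M]) /\
  ((forall i : nat, (0 < i)%N ->
      eventuallyPeriodic (fun n => f (negExponent p s1 s2 i n))) /\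
   (forall j : nat, (0 < j)%N ->
      eventuallyPeriodic (fun n => f (negExponent p s1 s2 n j)))).
Proof.
have [e e0 cardF] := card_finField_expn charF.
have s1p : (s1 < p)%N := ltn_ord s1; have s2p : (s2 < p)%N := ltn_ord s2.
move: (s1 : nat) (s2 : nat) s1p s2p supp_f => {s1 s2} s1 s2 s1p s2p supp_f.
pose E := negExponent p s1 s2.
have E1 i i' j : s1 = 0%N -> E i j = E i' j.
  by move=> s10; rewrite /E /negExponent s10 !mul0r.
have E2 i j j' : s2 = 0%N -> E i j = E i j'.
  by move=> s20; rewrite /E /negExponent s20 !mul0r.
split.
  move=> /(@algebraic_powerSeries2_relation _ _ _ (fun k => p ^ (e * k))%N).
  move=> [d [a [aP a0 af]]].
  have per : exists M N : nat, [/\ (0 < M)%N, (0 < N)%N &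
     forall i0 j0 : nat, (0 < i0)%N -> (0 < j0)%N ->
       periodicAfter (fun n => f (E (i0 + n) (j0 + n))%N) N M].
    exact: (@relation_periodic p F charF le false s1 s2 s1p s2p f supp_f e e0 cardF d a aP a0 af).
  have diag : eventuallyPeriodic (fun n => f (E n n)).
    have [M [N [_ N0 MN]]] := per; apply: eventuallyPeriodic_succ.
    by exists N, M; split=> //; apply: (MN 1%N 1%N).
  split=> //.
  (* If s1 = 0, the exponent does not depend on i: the sequences in i are constant, and those in j
     agree with the diagonal. The case s2 = 0 is symmetric. *)
  have [s10|s10] := posnP s1.
    split=> [i i0|j j0]; last first.
      rewrite (_ : (fun n => _) = fun=> f (E 0%N j)); first exact: eventuallyPeriodic_const.
      by apply/funext => n; rewrite -[RHS](congr1 f (E1 n 0%N j s10)).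
    rewrite (_ : (fun n => _) = fun n => f (E n n)) //.
    by apply/funext => n; rewrite (E1 n i n s10).
  have [s20|s20] := posnP s2.
    split=> [i i0|j j0].
      rewrite (_ : (fun n => _) = fun=> f (E i 0%N)); first exact: eventuallyPeriodic_const.
      by apply/funext => n; rewrite -[RHS](congr1 f (E2 i n 0%N s20)).
    rewrite (_ : (fun n => _) = fun n => f (E n n)) //.
    by apply/funext => n; rewrite (E2 n n j s20).
  split=> [i i0|j j0]; apply: eventuallyPeriodic_succ; apply: annihilated_periodic.
    apply: (@relation_annihilated p F charF le true s2 s1 s2p s1p f _
      e e0 cardF d a aP a0 af) => //.
    by move=> c /supp_f[i' [j' [i'0 j'0 ->]]]; exists j', i'.
  exact: (@relation_annihilated p F charF le false s1 s2 s1p s2p f supp_f e e0 cardF d a aP a0 af).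
move=> [[M [N [_ N0 MN]]] [f_row f_col]].
(* If both vanish, f is a single monomial; if just one does, f is a single row or column, for which
   the index 1 is a representative. *)
have [s10|s10] := posnP s1; have [s20|s20] := posnP s2.
- have -> : f = hmono le (f (E 1%N 1%N)) (E 1%N 1%N).
    apply: hahnP => a; rewrite hmonoE; case: eqP => [->//|aE].
    apply/eqP; apply: contra_notT aE => /supp_f[i [j [_ _ ->]]].
    by rewrite -/(E i j) (E1 i 1%N j s10) (E2 1%N j 1%N s20).
  exact: (algebraic_hmono charF le false s1 s2 1 1).
- apply: (@algebraic_row p F charF le e e0 cardF false s1 s2 1 f) => //.
    move=> a /supp_f[i [j [_ j0 ->]]]; exists j => //.
    exact: E1 i 1%N j s10.
  exact: f_row 1%N isT.
- apply: (@algebraic_row p F charF le e e0 cardF true s2 s1 1 f) => //.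
    move=> a /supp_f[i [j [i0 _ ->]]]; exists i => //.
    exact: E2 i j 1%N s20.
  exact: f_col 1%N isT.
exact: (@algebraic_array p F charF le e e0 cardF s1 s2 f N M).
Qed.
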